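(* Let $(H,G,\phi,R)$ and $(K,L,\varphi,S)$ be isoclinic relative Rota-Baxter groups. Then their induced skew left braces $H_R$ and $K_S$ are also isoclinic.
   Context: A relative Rota-Baxter group is a quadruple $(H,G,\phi,R)$, where $H$ and $G$ are groups, $\phi: G\to \mathrm{Aut}(H)$, $g\mapsto \phi_g$, is a group homomorphism, and $R:H\to G$ is a map satisfying $R(h_1)R(h_2)=R(h_1\phi_{R(h_1)}(h_2))$ for all $h_1,h_2\in H$. A homomorphism $(\psi,\eta):(H,G,\phi,R)\to(K,L,\varphi,S)$ is a pair of group homomorphisms $\psi:H\to K$, $\eta:G\to L$ with $\eta\, R=S\,\psi$ and $\psi\,\phi_g=\varphi_{\eta(g)}\,\psi$ for all $g\in G$; it is an isomorphism if $\psi$ and $\eta$ are group isomorphisms. A skew left brace is a triple $(H,\cdot,\circ)$ where $(H,\cdot)$ and $(H,\circ)$ are groups such that $a\circ(b\cdot c)=(a\circ b)\cdot a^{-1}\cdot(a\circ c)$ for all $a,b,c\in H$ ($a^{-1}$ is the inverse in $(H,\cdot)$). Its homomorphisms are maps preserving both operations. The skew left brace induced by $(H,G,\phi,R)$ is $H_R=(H,\cdot,\circ_R)$, where $\cdot$ is the operation of $H$ and $h_1\circ_R h_2=h_1\phi_{R(h_1)}(h_2)$; it is known that $\circ_R$ is a group operation and $R:(H,\circ_R)\to G$ is a group homomorphism. Isoclinism of relative Rota-Baxter groups. Put $Z^{\phi}_R(H)=Z(H)\cap \mathrm{Ker}(\phi R)\cap \mathrm{Fix}(\phi)$, where $Z(H)$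 is the center of $H$, $\mathrm{Ker}(\phi R)=\{h\in H\mid \phi_{R(h)}=\mathrm{Id}_H\}$ and $\mathrm{Fix}(\phi)=\{x\in H\mid \phi_g(x)=x \text{ for all } g\in G\}$. The center of $(H,G,\phi,R)$ is $Z(H,G,\phi,R)=(Z^{\phi}_R(H),\mathrm{Ker}(\phi),\phi|,R|)$ (bars denote restrictions). The quotient $(H,G,\phi,R)/Z(H,G,\phi,R)$ is the relative Rota-Baxter group $(H/Z^{\phi}_R(H),G/\mathrm{Ker}(\phi),\overline{\phi},\overline{R})$ with $\overline{\phi}_{\overline{g}}(\overline{h})=\overline{\phi_g(h)}$ and $\overline{R}(\overline{h})=\overline{R(h)}$. Let $H^{\phi}$ be the subgroup of $H$ generated by $[H,H]$ and all $\phi_g(h)h^{-1}$ ($g\in G$, $h\in H$). The commutator of $(H,G,\phi,R)$ is the relative Rota-Baxter group $(H,G,\phi,R)'=(H^{\phi},G,\phi|,R|)$. There are well-defined maps $\omega_H,\omega^{\phi}_H:(H/Z^{\phi}_R(H))\times(H/Z^{\phi}_R(H))\to H^{\phi}$ given by $\omega_H(\overline{h}_1,\overline{h}_2)=[h_1,h_2]$ and $\omega^{\phi}_H(\overline{h}_1,\overline{h}_2)=\phi_{R(h_1)}(h_2)h_2^{-1}$. The groups $(H,G,\phi,R)$ and $(K,L,\varphi,S)$ are isoclinic if there are isomorphisms of relative Rota-Baxter groups $(\psi_1,\eta_1):(H,G,\phi,R)/Z(H,G,\phi,R)\to(K,L,\varphi,S)/Z(K,L,\varphi,S)$ and $(\psi_2,\eta_2):(H,G,\phi,R)'\to(K,L,\varphi,S)'$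 such that $\psi_2\,\omega_H=\omega_K\,(\psi_1\times\psi_1)$ and $\psi_2\,\omega^{\phi}_H=\omega^{\varphi}_K\,(\psi_1\times\psi_1)$. Isoclinism of skew left braces. For a skew left brace $(H,\cdot,\circ)$, the annihilator is the ideal $\mathrm{Ann}(H)=\{a\in H\mid b\circ a=a\circ b=b\cdot a=a\cdot b\text{ for all }b\in H\}$. An ideal is a sub skew left brace $I$ that is normal in both $(H,\cdot)$ and $(H,\circ)$ and satisfies $\lambda_a(I)\subseteq I$ for all $a\in H$, where $\lambda_a(b)=a^{-1}\cdot(a\circ b)$. $H^{(2)}$ is the ideal generated by all $a^{-1}\cdot(a\circ b)\cdot b^{-1}$ ($a,b\in H$), and the commutator $H'$ is the subgroup of $(H,\cdot)$ generated by the commutator subgroup of $(H,\cdot)$ and $H^{(2)}$; it is an ideal of $(H,\cdot,\circ)$. There are well-defined maps $\theta_H,\theta^*_H:(H/\mathrm{Ann}(H))\times(H/\mathrm{Ann}(H))\to H'$ given by $\theta_H(\overline{a},\overline{b})=a\cdot b\cdot a^{-1}\cdot b^{-1}$ and $\theta^*_H(\overline{a},\overline{b})=a^{-1}\cdot(a\circ b)\cdot b^{-1}$. Two skew left braces $H$ and $K$ are isoclinic if there are isomorphisms of skew left braces $\xi_1:H/\mathrm{Ann}(H)\to K/\mathrm{Ann}(K)$ and $\xi_2:H'\to K'$ such that $\xi_2\,\theta_H=\theta_K\,(\xi_1\times\xi_1)$ and $\xi_2\,\theta^*_H=\theta^*_K\,(\xi_1\times\xi_1)$. *)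

(* Defs.v *)
From HB Require Import structures.
From mathcomp Require Import all_boot.
From mathcomp Require Import boolp classical_sets.

Set Implicit Arguments.
Unset Strict Implicit.
Unset Printing Implicit Defensive.

Local Open Scope classical_set_scope.
Local Open Scope quotient_scope.
Local Open Scope group_scope.

Reserved Notation "x ∘ y" (at level 40, left associativity).

(* Groups are the possibly infinite [groupType]s of monoid.v. The choiceType  *)
(* structure they carry is no restriction: with the axioms of boolp, every    *)
(* type has one. Subgroups are arbitrary (classical) subsets.                 *)

Section Subgroups.
Variable T : groupType.

Record subgroup := Subgroup {
  subgroup_set :> set T;
  subgroup_closed : group_closed (mem subgroup_set) }.

Record normalSubgroup := NormalSubgroup {
  normal_subgroup :> subgroup;
  normal_conj : forall x y, y \in subgroup_set normal_subgroup ->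
    x * y * x^-1 \in subgroup_set normal_subgroup }.

Lemma subgroup1 (S : subgroup) : 1 \in subgroup_set S.
Proof. by case: (subgroup_closed S). Qed.

Lemma subgroupV (S : subgroup) x :
  x \in subgroup_set S -> x^-1 \in subgroup_set S.
Proof. exact: (group_closedV (subgroup_closed S)). Qed.

Lemma subgroupM (S : subgroup) x y :
  x \in subgroup_set S -> y \in subgroup_set S -> x * y \in subgroup_set S.
Proof. exact: (group_closedM (subgroup_closed S)). Qed.

Definition gen_set (A : set T) : set T :=
  [set x | forall S : subgroup, A `<=` S -> subgroup_set S x].

Lemma gen_closed A : group_closed (mem (gen_set A)).
Proof.
split=> [|x y]; rewrite !inE.
  by move=> S _; have := subgroup1 S; rewrite inE.
move=> Ax Ay S AS.
have := subgroupM (mem_set (Ax S AS)) (subgroupV (mem_set (Ay S AS))).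
by rewrite inE.
Qed.

Definition gen (A : set T) : subgroup := Subgroup (gen_closed A).

Lemma sub_gen (A : set T) : A `<=` gen A.
Proof. by move=> x Ax S; apply. Qed.

Lemma gen_ind (A : set T) (P : set T) :
  group_closed (mem P) -> A `<=` P -> gen A `<=` P.
Proof. by move=> cP AP x /(_ (Subgroup cP)); apply. Qed.

(* [monoid.commg], denoted [~ x, y], is x^-1 y^-1 x y: the convention used    *)
(* here is the other one, as in the definition of theta below.                *)
Definition comm (x y : T) : T := x * y * x^-1 * y^-1.

Definition derived : subgroup := gen [set z | exists x y, z = comm x y].

Definition center : set T := [set x | forall y, x * y = y * x].

Lemma comm_centerl h k z : center z -> comm (h * z) k = comm h k.
Proof. by move=> cz; rewrite /comm invgM -(mulgA h) cz !mulgA mulgK. Qed.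

Lemma comm_centerr h k z : center z -> comm h (k * z) = comm h k.
Proof.
move=> cz; rewrite /comm invgM !mulgA -(mulgA (h * k)) cz !mulgA.
by rewrite mulgK.
Qed.

Definition subg (S : subgroup) : Type := {x : T | x \in subgroup_set S}.
HB.instance Definition _ (S : subgroup) := SubChoice.on (subg S).
HB.instance Definition _ (S : subgroup) :=
  SubChoice_isSubGroup.Build T (fun x => x \in subgroup_set S) (subg S)
    (subgroup_closed S).

Section Quotient.
Variable N : normalSubgroup.

Definition qrel : rel T := fun x y => x^-1 * y \in subgroup_set N.

Lemma qrel_refl : reflexive qrel.
Proof. by move=> x; rewrite /qrel mulVg subgroup1. Qed.

Lemma qrel_sym : symmetric qrel.
Proof.
by move=> x y; apply/idP/idP => /subgroupV; rewrite invgM invgK.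
Qed.

Lemma qrel_trans : transitive qrel.
Proof.
move=> y x z Nxy Nyz; have := subgroupM Nxy Nyz.
by rewrite mulgA mulgK.
Qed.

Canonical qrel_equiv := EquivRel qrel qrel_refl qrel_sym qrel_trans.

Definition quot : Type := {eq_quot qrel_equiv}.
HB.instance Definition _ := Choice.on quot.
HB.instance Definition _ := EqQuotient.on quot.

Lemma quotP (x y : T) : \pi_quot x = \pi_quot y <-> x^-1 * y \in subgroup_set N.
Proof. by split=> [/eqmodP|H]; [|apply/eqmodP]. Qed.

Lemma repr_pi (x : T) :
  exists2 z, z \in subgroup_set N & repr (\pi_quot x) = x * z.
Proof.
exists (x^-1 * repr (\pi_quot x)); last by rewrite mulVKg.
by apply/quotP; rewrite reprK.
Qed.

Definition qone : quot := \pi_quot 1.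
Definition qmul (a b : quot) : quot := \pi_quot (repr a * repr b).
Definition qinv (a : quot) : quot := \pi_quot (repr a)^-1.

Lemma qmulE x y : qmul (\pi_quot x) (\pi_quot y) = \pi_quot (x * y).
Proof.
rewrite /qmul; have [z Nz ->] := repr_pi x; have [w Nw ->] := repr_pi y.
apply/esym/quotP; rewrite invgM.
rewrite (_ : _ * _ = (y^-1 * z * y) * w); last by rewrite !mulgA mulgVK.
by apply: subgroupM => //; have := normal_conj y^-1 Nz; rewrite invgK.
Qed.

Lemma qinvE x : qinv (\pi_quot x) = \pi_quot x^-1.
Proof.
rewrite /qinv; have [z Nz ->] := repr_pi x; apply/esym/quotP.
by rewrite invgK invgM mulgA normal_conj ?subgroupV.
Qed.

Lemma quot_ind (P : quot -> Prop) : (forall x : T, P (\pi_quot x)) -> forall q, P q.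
Proof. exact: quotW. Qed.

Lemma qmulA : associative qmul.
Proof.
elim/quot_ind=> x; elim/quot_ind=> y; elim/quot_ind=> z.
by rewrite !qmulE mulgA.
Qed.
Lemma qmul1q : left_id qone qmul.
Proof. by elim/quot_ind=> x; rewrite qmulE mul1g. Qed.
Lemma qmulq1 : right_id qone qmul.
Proof. by elim/quot_ind=> x; rewrite qmulE mulg1. Qed.
Lemma qmulVq : left_inverse qone qinv qmul.
Proof. by elim/quot_ind=> x; rewrite qinvE qmulE mulVg. Qed.
Lemma qmulqV : right_inverse qone qinv qmul.
Proof. by elim/quot_ind=> x; rewrite qinvE qmulE mulgV. Qed.

HB.instance Definition _ :=
  isGroup.Build quot qmulA qmul1q qmulq1 qmulVq qmulqV.

Lemma piM (x y : T) : \pi_quot (x * y) = \pi_quot x * \pi_quot y.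
Proof. by rewrite -qmulE. Qed.

Lemma pi_mulr (x z : T) : z \in subgroup_set N -> \pi_quot (x * z) = \pi_quot x.
Proof. by move=> Nz; apply/esym/quotP; rewrite mulKg. Qed.

End Quotient.
End Subgroups.

Lemma morph1 (T U : groupType) (f : T -> U) :
  {morph f : x y / x * y} -> f 1 = 1.
Proof. by move=> fM; apply: (mulgI (f 1)); rewrite -fM !mulg1. Qed.

Lemma morphV (T U : groupType) (f : T -> U) :
  {morph f : x y / x * y} -> {morph f : x / x^-1}.
Proof.
by move=> fM x; apply: (mulgI (f x)); rewrite -fM !mulgV (morph1 fM).
Qed.

Lemma morph_comm (T U : groupType) (f : T -> U) x y :
  {morph f : x y / x * y} -> f (comm x y) = comm (f x) (f y).
Proof. by move=> fM; rewrite /comm !fM !(morphV fM). Qed.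

(* [rrb_phiM], [rrb_phi_bij] and [rrb_phi_comp] say that [rrb_phi] is a       *)
(* homomorphism from G to Aut(H).                                             *)
Record rrbGroup := RRBGroup {
  rrbH : groupType;
  rrbG : groupType;
  rrb_phi : rrbG -> rrbH -> rrbH;
  rrb_R : rrbH -> rrbG;
  rrb_phiM : forall g, {morph rrb_phi g : h1 h2 / h1 * h2};
  rrb_phi_bij : forall g, bijective (rrb_phi g);
  rrb_phi_comp : forall g1 g2 h,
    rrb_phi (g1 * g2) h = rrb_phi g1 (rrb_phi g2 h);
  rrb_RP : forall h1 h2,
    rrb_R h1 * rrb_R h2 = rrb_R (h1 * rrb_phi (rrb_R h1) h2) }.

Record rrb_hom (X Y : rrbGroup) := RRBHom {
  hom_psi : rrbH X -> rrbH Y;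
  hom_eta : rrbG X -> rrbG Y;
  hom_psiM : {morph hom_psi : h1 h2 / h1 * h2};
  hom_etaM : {morph hom_eta : g1 g2 / g1 * g2};
  hom_R : forall h, hom_eta (rrb_R h) = rrb_R (hom_psi h);
  hom_phi : forall g h,
    hom_psi (rrb_phi g h) = rrb_phi (hom_eta g) (hom_psi h) }.

Definition rrb_is_iso (X Y : rrbGroup) (f : rrb_hom X Y) : Prop :=
  bijective (hom_psi f) /\ bijective (hom_eta f).

Section RRBTheory.
Variable X : rrbGroup.
Local Notation H := (rrbH X).
Local Notation G := (rrbG X).
Local Notation phi := (@rrb_phi X).
Local Notation R := (@rrb_R X).

Lemma rrb_phi_1 g : phi g 1 = 1.
Proof. exact: morph1 (rrb_phiM g). Qed.

Lemma rrb_phiV g : {morph phi g : h / h^-1}.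
Proof. exact: morphV (rrb_phiM g). Qed.

Lemma rrb_1phi h : phi 1 h = h.
Proof.
by apply: (bij_inj (rrb_phi_bij (1 : G))); rewrite -rrb_phi_comp mulg1.
Qed.

Lemma rrb_phiK g : cancel (phi g) (phi g^-1).
Proof. by move=> h; rewrite -rrb_phi_comp mulVg rrb_1phi. Qed.

Lemma rrb_phiVK g : cancel (phi g^-1) (phi g).
Proof. by move=> h; rewrite -rrb_phi_comp mulgV rrb_1phi. Qed.

Lemma rrb_R1 : R 1 = 1.
Proof. by apply: (mulgI (R 1)); rewrite rrb_RP rrb_phi_1 !mulg1. Qed.

(* [zcen] is Z^phi_R(H); it is the first component of the center of X, the    *)
(* second one being [kerphi].                                                 *)
Definition kerR : set H := [set h | forall x, phi (R h) x = x].
Definition fixphi : set H := [set x | forall g, phi g x = x].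
Definition zcen_set : set H := @center H `&` kerR `&` fixphi.

Lemma zcen_RM (h z : H) : z \in zcen_set -> R (h * z) = R h * R z.
Proof. by rewrite inE => -[_ zfix]; rewrite rrb_RP zfix. Qed.

Lemma zcen_closed : group_closed (mem zcen_set).
Proof.
have zV (x : H) : x \in zcen_set -> R x^-1 = (R x)^-1.
  rewrite inE => -[_ fx]; apply: (mulgI (R x)).
  by rewrite rrb_RP rrb_phiV fx !mulgV rrb_R1.
have z1 : 1 \in zcen_set.
  rewrite inE; split; last by move=> g; rewrite rrb_phi_1.
  by split=> x; rewrite ?mulg1 ?mul1g // rrb_R1 rrb_1phi.
split=> // x y zx zy.
have [[cx kx] fx] := set_mem zx; have [[cy ky] fy] := set_mem zy.
rewrite inE; split; last by move=> g; rewrite rrb_phiM rrb_phiV fx fy.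
split=> u.
  rewrite -mulgA [RHS]mulgA -cx -mulgA; congr (_ * _).
  by apply: (mulgI y); rewrite mulVKg mulgA cy mulgK.
have -> : R (x * y^-1) = R x * R y^-1 by rewrite rrb_RP kx.
by rewrite zV // rrb_phi_comp kx -[in LHS](ky u) rrb_phiK.
Qed.

Lemma zcen_normal x y : y \in zcen_set -> x * y * x^-1 \in zcen_set.
Proof. by move=> zy; have [[cy _] _] := set_mem zy; rewrite -cy mulgK. Qed.

Definition zcen : normalSubgroup H :=
  @NormalSubgroup H (Subgroup zcen_closed) zcen_normal.

Definition kerphi_set : set G := [set g | forall x, phi g x = x].

Lemma kerphi_closed : group_closed (mem kerphi_set).
Proof.
split=> [|x y]; rewrite !inE; first by move=> h; rewrite rrb_1phi.
by move=> kx ky h; rewrite rrb_phi_comp kx -[in LHS](ky h) rrb_phiK.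
Qed.

Lemma kerphi_normal x y : y \in kerphi_set -> x * y * x^-1 \in kerphi_set.
Proof.
by rewrite !inE => ky h; rewrite !rrb_phi_comp ky rrb_phiVK.
Qed.

Definition kerphi : normalSubgroup G :=
  @NormalSubgroup G (Subgroup kerphi_closed) kerphi_normal.

Local Notation piH := (\pi_(quot zcen)).
Local Notation piG := (\pi_(quot kerphi)).

(* By [qphiE] and [qRE], these two maps do not depend on the choice of        *)
(* representatives.                                                           *)
Definition qphi (g : quot kerphi) (h : quot zcen) : quot zcen :=
  piH (phi (repr g) (repr h)).
Definition qR (h : quot zcen) : quot kerphi := piG (R (repr h)).

Lemma qphiE g h : qphi (piG g) (piH h) = piH (phi g h).
Proof.
rewrite /qphi; have [k /set_mem kk ->] := repr_pi kerphi g.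
have [z zz ->] := repr_pi zcen h; have [_ fz] := set_mem zz.
by rewrite rrb_phi_comp kk rrb_phiM fz pi_mulr.
Qed.

Lemma qRE h : qR (piH h) = piG (R h).
Proof.
rewrite /qR; have [z zz ->] := repr_pi zcen h; rewrite zcen_RM // pi_mulr //.
by have [[_ kz] _] := set_mem zz; rewrite inE.
Qed.

Lemma qphiM g : {morph qphi g : h1 h2 / h1 * h2}.
Proof.
elim/quot_ind: g => g; elim/quot_ind=> x; elim/quot_ind=> y.
by rewrite -piM !qphiE rrb_phiM piM.
Qed.

Lemma qphi_bij g : bijective (qphi g).
Proof.
elim/quot_ind: g => g; exists (qphi (piG g^-1)); elim/quot_ind=> h;
  by rewrite !qphiE ?rrb_phiK ?rrb_phiVK.
Qed.

Lemma qphi_comp g1 g2 h : qphi (g1 * g2) h = qphi g1 (qphi g2 h).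
Proof.
elim/quot_ind: g1 => g1; elim/quot_ind: g2 => g2; elim/quot_ind: h => h.
by rewrite -piM !qphiE rrb_phi_comp.
Qed.

Lemma qRP h1 h2 : qR h1 * qR h2 = qR (h1 * qphi (qR h1) h2).
Proof.
elim/quot_ind: h1 => h1; elim/quot_ind: h2 => h2.
by rewrite (qRE h1) (qRE h2) qphiE -(piM zcen) qRE -(piM kerphi) rrb_RP.
Qed.

Definition rrb_quot : rrbGroup := RRBGroup qphiM qphi_bij qphi_comp qRP.

(* [Hphi] is H^phi, the first component of the commutator [rrb_comm] of X.    *)
Definition Hphi : subgroup H :=
  gen (derived H `|` [set x | exists g h, x = phi g h * h^-1]).

Lemma Hphi_phi g h : phi g h * h^-1 \in subgroup_set Hphi.
Proof. by rewrite inE; apply: sub_gen; right; exists g, h. Qed.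

Lemma Hphi_comm h1 h2 : comm h1 h2 \in subgroup_set Hphi.
Proof.
by rewrite inE; apply: sub_gen; left; apply: sub_gen; exists h1, h2.
Qed.

Lemma Hphi_stable g x :
  x \in subgroup_set Hphi -> phi g x \in subgroup_set Hphi.
Proof.
by move=> Sx; rewrite -[phi g x](mulgVK x) subgroupM ?Hphi_phi.
Qed.

Definition cphi (g : G) (x : subg Hphi) : subg Hphi :=
  Sub (phi g (val x)) (Hphi_stable g (valP x)).
Definition cR (x : subg Hphi) : G := R (val x).

Lemma cphiM g : {morph cphi g : x y / x * y}.
Proof. by move=> x y; apply: val_inj; exact: rrb_phiM. Qed.

Lemma cphi_bij g : bijective (cphi g).
Proof.
exists (cphi g^-1) => x; apply: val_inj; rewrite !SubK.
  exact: rrb_phiK.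
exact: rrb_phiVK.
Qed.

Lemma cphi_comp g1 g2 x : cphi (g1 * g2) x = cphi g1 (cphi g2 x).
Proof. by apply: val_inj; exact: rrb_phi_comp. Qed.

Lemma cRP x y : cR x * cR y = cR (x * cphi (cR x) y).
Proof. exact: rrb_RP. Qed.

Definition rrb_comm : rrbGroup := RRBGroup cphiM cphi_bij cphi_comp cRP.

(* By [omegaE] and [omega_phiE], the values of the next two maps do not       *)
(* depend on the choice of representatives.                                   *)
Definition omega (a b : quot zcen) : subg Hphi :=
  Sub (comm (repr a) (repr b)) (Hphi_comm _ _).
Definition omega_phi (a b : quot zcen) : subg Hphi :=
  Sub (phi (R (repr a)) (repr b) * (repr b)^-1) (Hphi_phi _ _).

Lemma omegaE h1 h2 : val (omega (piH h1) (piH h2)) = comm h1 h2.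
Proof.
rewrite SubK; have [z /set_mem[[cz _] _] ->] := repr_pi zcen h1.
have [w /set_mem[[cw _] _] ->] := repr_pi zcen h2.
by rewrite comm_centerl // comm_centerr.
Qed.

Lemma omega_phiE h1 h2 :
  val (omega_phi (piH h1) (piH h2)) = phi (R h1) h2 * h2^-1.
Proof.
rewrite SubK; have [z zz ->] := repr_pi zcen h1.
have [w /set_mem[_ fw] ->] := repr_pi zcen h2.
have [[_ kz] _] := set_mem zz.
by rewrite zcen_RM // rrb_phi_comp kz rrb_phiM fw invgM mulgA mulgK.
Qed.

End RRBTheory.

Definition rrb_isoclinic (X Y : rrbGroup) : Prop :=
  exists (f1 : rrb_hom (rrb_quot X) (rrb_quot Y))
         (f2 : rrb_hom (rrb_comm X) (rrb_comm Y)),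
  [/\ rrb_is_iso f1,
      rrb_is_iso f2,
      forall a b, hom_psi f2 (omega a b) = omega (hom_psi f1 a) (hom_psi f1 b)
    & forall a b,
        hom_psi f2 (omega_phi a b) = omega_phi (hom_psi f1 a) (hom_psi f1 b)].

HB.mixin Record Group_isSkewBrace H of Group H := {
  circ : H -> H -> H;
  cone : H;
  cinv : H -> H;
  circA : associative circ;
  circ1x : left_id cone circ;
  circx1 : right_id cone circ;
  circVx : left_inverse cone cinv circ;
  circxV : right_inverse cone cinv circ;
  circMr : forall a b c : H, circ a (b * c) = circ a b * a^-1 * circ a c }.

#[short(type="skewBraceType")]
HB.structure Definition SkewBrace := {H of Group_isSkewBrace H & Group H}.

Notation "x ∘ y" := (circ x y) : group_scope.

Section BraceTheory.
Variable H : skewBraceType.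
Implicit Types a b c : H.

Definition lam a b : H := a^-1 * (a ∘ b).
Definition star a b : H := a^-1 * (a ∘ b) * b^-1.

Lemma circE a b : a ∘ b = a * lam a b.
Proof. by rewrite mulVKg. Qed.

Lemma lamM a : {morph lam a : b c / b * c}.
Proof. by move=> b c; rewrite /lam circMr !mulgA. Qed.

Lemma lam_1 a : lam a 1 = 1.
Proof. exact: morph1 (@lamM a). Qed.

Lemma lamV a : {morph lam a : b / b^-1}.
Proof. exact: morphV (@lamM a). Qed.

Lemma coneE : @cone H = 1.
Proof. by rewrite -[LHS]mulg1 -[in LHS](lam_1 cone) -circE circ1x. Qed.

Lemma lam_circ a b c : lam (a ∘ b) c = lam a (lam b c).
Proof.
apply: (mulgI (lam a b)); rewrite -lamM -circE {1}/lam -mulgA -circE.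
by rewrite -circA.
Qed.

Lemma lam1 a : lam 1 a = a.
Proof. by rewrite /lam invg1 mul1g -coneE circ1x. Qed.

Lemma lamK a : cancel (lam a) (lam (cinv a)).
Proof. by move=> b; rewrite -lam_circ circVx coneE lam1. Qed.

Lemma lamVK a : cancel (lam (cinv a)) (lam a).
Proof. by move=> b; rewrite -lam_circ circxV coneE lam1. Qed.

Lemma cinvE a : cinv a = lam (cinv a) a^-1.
Proof.
apply: (can_inj (lamK a)); rewrite lamVK.
by apply: (mulgI a); rewrite -circE circxV coneE mulgV.
Qed.

Record subBrace := SubBrace {
  subBrace_subgroup :> subgroup H;
  subBrace_circ : forall x y, x \in subgroup_set subBrace_subgroup ->
    y \in subgroup_set subBrace_subgroup ->
    x ∘ y \in subgroup_set subBrace_subgroup;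
  subBrace_cinv : forall x, x \in subgroup_set subBrace_subgroup ->
    cinv x \in subgroup_set subBrace_subgroup }.

Record ideal := Ideal {
  ideal_subBrace :> subBrace;
  ideal_normal : forall x y, y \in subgroup_set ideal_subBrace ->
    x * y * x^-1 \in subgroup_set ideal_subBrace;
  ideal_cnormal : forall x y, y \in subgroup_set ideal_subBrace ->
    x ∘ y ∘ cinv x \in subgroup_set ideal_subBrace;
  ideal_lam : forall x y, y \in subgroup_set ideal_subBrace ->
    lam x y \in subgroup_set ideal_subBrace }.

Definition ideal_normalSubgroup (I : ideal) : normalSubgroup H :=
  NormalSubgroup (@ideal_normal I).

Section BraceOfSub.
Variable S : subBrace.

Definition sbrace : Type := subg S.
HB.instance Definition _ := SubGroup.on sbrace.

Lemma sub_cone : @cone H \in subgroup_set S.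
Proof. by rewrite coneE subgroup1. Qed.

Definition scirc (x y : sbrace) : sbrace :=
  Sub (val x ∘ val y) (subBrace_circ (valP x) (valP y)).
Definition scone : sbrace := Sub cone sub_cone.
Definition scinv (x : sbrace) : sbrace :=
  Sub (cinv (val x)) (subBrace_cinv (valP x)).

Lemma scircA : associative scirc.
Proof. by move=> x y z; apply: val_inj; rewrite !SubK circA. Qed.
Lemma scirc1x : left_id scone scirc.
Proof. by move=> x; apply: val_inj; rewrite !SubK circ1x. Qed.
Lemma scircx1 : right_id scone scirc.
Proof. by move=> x; apply: val_inj; rewrite !SubK circx1. Qed.
Lemma scircVx : left_inverse scone scinv scirc.
Proof. by move=> x; apply: val_inj; rewrite !SubK circVx. Qed.
Lemma scircxV : right_inverse scone scinv scirc.
Proof. by move=> x; apply: val_inj; rewrite !SubK circxV. Qed.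
Lemma scircMr x y z : scirc x (y * z) = scirc x y * x^-1 * scirc x z.
Proof.
by apply: val_inj; exact: circMr.
Qed.

HB.instance Definition _ := Group_isSkewBrace.Build sbrace
  scircA scirc1x scircx1 scircVx scircxV scircMr.
End BraceOfSub.

Section BraceQuotient.
Variable I : ideal.
Local Notation N := (ideal_normalSubgroup I).

Definition qbrace : Type := quot N.
HB.instance Definition _ := Group.on qbrace.
HB.instance Definition _ := EqQuotient.on qbrace.

Definition qcirc (x y : qbrace) : qbrace := \pi_qbrace (repr x ∘ repr y).
Definition qcone : qbrace := \pi_qbrace cone.
Definition qcinv (x : qbrace) : qbrace := \pi_qbrace (cinv (repr x)).

Lemma qbrace_repr (x : H) :
  exists2 z, z \in subgroup_set I & repr (\pi_qbrace x) = x ∘ z.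
Proof.
have [z Iz e] := repr_pi N x.
exists (lam (cinv x) z); first exact: ideal_lam.
by rewrite circE lamVK.
Qed.

Lemma qbrace_circr (x z : H) :
  z \in subgroup_set I -> \pi_qbrace (x ∘ z) = \pi_qbrace x.
Proof. by move=> Iz; rewrite circE; apply: (@pi_mulr H N); apply: ideal_lam. Qed.

Lemma cinvM a b : cinv (a ∘ b) = cinv b ∘ cinv a.
Proof.
rewrite -[RHS]circ1x -(circVx (a ∘ b)) -!circA (circA b) circxV circ1x.
by rewrite circxV circx1.
Qed.

Lemma cinvK a : cinv (cinv a) = a.
Proof. by rewrite -[LHS]circx1 -(circVx a) circA circVx circ1x. Qed.

Lemma qcircE x y : qcirc (\pi_qbrace x) (\pi_qbrace y) = \pi_qbrace (x ∘ y).
Proof.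
rewrite /qcirc; have [z Iz ->] := qbrace_repr x.
have [w Iw ->] := qbrace_repr y.
rewrite circA qbrace_circr // -(circA x).
rewrite (_ : z ∘ y = y ∘ (cinv y ∘ z ∘ y)).
  rewrite circA qbrace_circr //.
  by have := ideal_cnormal (cinv y) Iz; rewrite cinvK.
by rewrite !circA circxV circ1x.
Qed.

Lemma qcinvE x : qcinv (\pi_qbrace x) = \pi_qbrace (cinv x).
Proof.
rewrite /qcinv; have [z Iz ->] := qbrace_repr x.
rewrite cinvM (_ : _ ∘ _ = cinv x ∘ (x ∘ cinv z ∘ cinv x)).
  by rewrite qbrace_circr // ideal_cnormal // subBrace_cinv.
by rewrite !circA circVx circ1x.
Qed.

Lemma qbrace_ind (P : qbrace -> Prop) :
  (forall x : H, P (\pi_qbrace x)) -> forall q, P q.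
Proof. exact: quotW. Qed.

Lemma qcircA : associative qcirc.
Proof.
elim/qbrace_ind=> x; elim/qbrace_ind=> y; elim/qbrace_ind=> z.
by rewrite !qcircE circA.
Qed.
Lemma qcirc1x : left_id qcone qcirc.
Proof. by elim/qbrace_ind=> x; rewrite qcircE circ1x. Qed.
Lemma qcircx1 : right_id qcone qcirc.
Proof. by elim/qbrace_ind=> x; rewrite qcircE circx1. Qed.
Lemma qcircVx : left_inverse qcone qcinv qcirc.
Proof. by elim/qbrace_ind=> x; rewrite qcinvE qcircE circVx. Qed.
Lemma qcircxV : right_inverse qcone qcinv qcirc.
Proof. by elim/qbrace_ind=> x; rewrite qcinvE qcircE circxV. Qed.

Lemma qbraceM (x y : H) : \pi_qbrace (x * y) = \pi_qbrace x * \pi_qbrace y.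
Proof. exact: (piM N). Qed.
Lemma qbraceV (x : H) : \pi_qbrace x^-1 = (\pi_qbrace x)^-1.
Proof. exact/esym/(qinvE N). Qed.

Lemma qcircMr x y z : qcirc x (y * z) = qcirc x y * x^-1 * qcirc x z.
Proof.
elim/qbrace_ind: x => x; elim/qbrace_ind: y => y; elim/qbrace_ind: z => z.
by rewrite -qbraceM -qbraceV !qcircE circMr !qbraceM.
Qed.

HB.instance Definition _ := Group_isSkewBrace.Build qbrace
  qcircA qcirc1x qcircx1 qcircVx qcircxV qcircMr.
End BraceQuotient.

Definition ann_set : set H :=
  [set a | forall b, [/\ b ∘ a = a ∘ b, a ∘ b = b * a & b * a = a * b]].

Lemma annP a : a \in ann_set <->
  [/\ forall b, a * b = b * a, forall b, lam a b = b & forall b, lam b a = a].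
Proof.
rewrite inE; split=> [Aa | [ca la fa] b].
  split=> b; have [e1 e2 e3] := Aa b; rewrite // /lam.
    by rewrite e2 e3 mulKg.
  by rewrite e1 e2 mulKg.
by rewrite !circE la fa ca.
Qed.

Lemma ann_closed : group_closed (mem ann_set).
Proof.
split=> [|x y]; first by apply/annP; split=> b; rewrite ?mulg1 ?mul1g ?lam1 ?lam_1.
move=> /annP[cx lx fx] /annP[cy ly fy]; apply/annP; split=> b.
- rewrite -mulgA [RHS]mulgA -cx -mulgA; congr (_ * _).
  by apply: (mulgI y); rewrite mulVKg mulgA cy mulgK.
- rewrite -[x * _](congr1 (mul x) (lx y^-1)) -circE lam_circ lx.
  have -> : y^-1 = cinv y.
    by apply: (mulgI y); rewrite mulgV -[cinv y]ly -circE circxV coneE.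
  by rewrite -[in LHS](ly b) lamK.
- by rewrite lamM lamV fx fy.
Qed.

Lemma ann_cinv x : x \in ann_set -> cinv x \in ann_set.
Proof.
move=> Ax; have [_ lx _] := (annP _).1 Ax.
have -> : cinv x = x^-1.
  by apply: (mulgI x); rewrite mulgV -[cinv x]lx -circE circxV coneE.
exact: (group_closedV ann_closed).
Qed.

Lemma ann_circ x y : x \in ann_set -> y \in ann_set -> x ∘ y \in ann_set.
Proof.
move=> Ax Ay; have [_ lx _] := (annP _).1 Ax; rewrite circE lx.
exact: (group_closedM ann_closed).
Qed.

Lemma ann_normal x y : y \in ann_set -> x * y * x^-1 \in ann_set.
Proof. by move=> Ay; have [cy _ _] := (annP _).1 Ay; rewrite -cy mulgK. Qed.

Lemma ann_cnormal x y : y \in ann_set -> x ∘ y ∘ cinv x \in ann_set.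
Proof.
move=> Ay; move: (Ay); rewrite inE => /(_ x)[-> _ _].
by rewrite -circA circxV circx1.
Qed.

Lemma ann_lam x y : y \in ann_set -> lam x y \in ann_set.
Proof. by move=> Ay; have [_ _ ->] := (annP _).1 Ay. Qed.

Definition ann : ideal :=
  @Ideal (@SubBrace (Subgroup ann_closed) ann_circ ann_cinv)
    ann_normal ann_cnormal ann_lam.

Definition ideal_gen (A : set H) : set H :=
  [set x | forall I : ideal, A `<=` I -> subgroup_set I x].

(* [brace2] is H^(2) and [brace_comm] is H'.                                  *)
Definition brace2 : set H := ideal_gen [set x | exists a b, x = star a b].

Definition brace_comm_subgroup : subgroup H := gen (derived H `|` brace2).

Lemma brace_comm_lam a x : x \in subgroup_set brace_comm_subgroup ->
  lam a x \in subgroup_set brace_comm_subgroup.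
Proof.
move=> /set_mem Sx; pose P := [set y | lam a y \in subgroup_set brace_comm_subgroup].
suff : P x by [].
have preP (S : subgroup H) :
    group_closed (mem [set y | lam a y \in subgroup_set S]).
  split=> [|u v]; rewrite !inE /= ?lam_1 ?subgroup1 //.
  by rewrite lamM lamV => ? ?; rewrite subgroupM ?subgroupV.
apply: gen_ind Sx; first exact: preP.
move=> y [Dy|By]; rewrite /P /= inE; apply: sub_gen; last first.
  right=> I sI; have := ideal_lam a (mem_set (By I sI)).
  by rewrite inE.
left; apply: set_mem.
apply: (gen_ind (preP (derived H)) _ Dy).
move=> _ [u [v ->]] /=; rewrite (morph_comm _ _ (@lamM a)) inE.
by apply: sub_gen; exists (lam a u), (lam a v).
Qed.

Lemma brace_comm_circ x y : x \in subgroup_set brace_comm_subgroup ->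
  y \in subgroup_set brace_comm_subgroup ->
  x ∘ y \in subgroup_set brace_comm_subgroup.
Proof.
by move=> Sx Sy; rewrite circE subgroupM ?brace_comm_lam.
Qed.

Lemma brace_comm_cinv x : x \in subgroup_set brace_comm_subgroup ->
  cinv x \in subgroup_set brace_comm_subgroup.
Proof. by move=> Sx; rewrite cinvE brace_comm_lam ?subgroupV. Qed.

Definition brace_comm : subBrace := SubBrace brace_comm_circ brace_comm_cinv.

Lemma brace_comm_comm a b : comm a b \in subgroup_set brace_comm.
Proof. by rewrite inE; apply: sub_gen; left; apply: sub_gen; exists a, b. Qed.

Lemma brace_comm_star a b : star a b \in subgroup_set brace_comm.
Proof.
by rewrite inE; apply: sub_gen; right=> I; apply; exists a, b.
Qed.

(* Independence of the representatives is [thetaE] and [theta_starE].        *)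
Definition theta (x y : qbrace ann) : sbrace brace_comm :=
  Sub (comm (repr x) (repr y)) (brace_comm_comm _ _).
Definition theta_star (x y : qbrace ann) : sbrace brace_comm :=
  Sub (star (repr x) (repr y)) (brace_comm_star _ _).

Local Notation piA := (\pi_(qbrace ann)).

Lemma thetaE a b : val (theta (piA a) (piA b)) = comm a b.
Proof.
have [z /annP[cz _ _] ea] := repr_pi (ideal_normalSubgroup ann) a.
have [w /annP[cw _ _] eb] := repr_pi (ideal_normalSubgroup ann) b.
by rewrite SubK [repr _]ea [repr _]eb comm_centerl // comm_centerr.
Qed.

Lemma theta_starE a b : val (theta_star (piA a) (piA b)) = star a b.
Proof.
have [z /annP[_ lz fz] ea] := repr_pi (ideal_normalSubgroup ann) a.
have [w /annP[_ _ fw] eb] := repr_pi (ideal_normalSubgroup ann) b.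
rewrite SubK [repr _]ea [repr _]eb /star -/(lam _ _) -/(lam a b).
rewrite -[a * z](congr1 (mul a) (fz a)) -circE lam_circ lz lamM fw.
by rewrite invgM mulgA mulgK.
Qed.

End BraceTheory.

Record brace_hom (A B : skewBraceType) := BraceHom {
  brace_fun :> A -> B;
  brace_homM : {morph brace_fun : x y / x * y};
  brace_hom_circ : {morph brace_fun : x y / x ∘ y} }.

Definition brace_isoclinic (A B : skewBraceType) : Prop :=
  exists (xi1 : brace_hom (qbrace (ann A)) (qbrace (ann B)))
         (xi2 : brace_hom (sbrace (brace_comm A)) (sbrace (brace_comm B))),
  [/\ bijective xi1,
      bijective xi2,
      forall x y, xi2 (theta x y) = theta (xi1 x) (xi1 y)
    & forall x y, xi2 (theta_star x y) = theta_star (xi1 x) (xi1 y)].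

Section Induced.
Variable X : rrbGroup.

Definition induced : Type := rrbH X.
HB.instance Definition _ := Group.on induced.

Definition icirc (h1 h2 : induced) : induced := h1 * rrb_phi (rrb_R h1) h2.
Definition icinv (h : induced) : induced := rrb_phi (rrb_R h)^-1 h^-1.

Lemma icirc_R h1 h2 : rrb_R (icirc h1 h2) = rrb_R h1 * rrb_R h2.
Proof. exact/esym/rrb_RP. Qed.

Lemma icircA : associative icirc.
Proof.
move=> x y z; rewrite [RHS]/icirc icirc_R rrb_phi_comp.
by rewrite /icirc rrb_phiM mulgA.
Qed.

Lemma icirc1x : left_id (1 : induced) icirc.
Proof. by move=> x; rewrite /icirc mul1g rrb_R1 rrb_1phi. Qed.

Lemma icircx1 : right_id (1 : induced) icirc.
Proof. by move=> x; rewrite /icirc rrb_phi_1 mulg1. Qed.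

Lemma icircxV : right_inverse (1 : induced) icinv icirc.
Proof. by move=> x; rewrite /icirc /icinv rrb_phiVK mulgV. Qed.

Lemma icircVx : left_inverse (1 : induced) icinv icirc.
Proof.
move=> x; have RV : rrb_R (icinv x) = (rrb_R x)^-1.
  by apply: (mulgI (rrb_R x)); rewrite -icirc_R icircxV rrb_R1 mulgV.
by rewrite /icirc RV /icinv rrb_phiV mulVg.
Qed.

Lemma icircMr x y z : icirc x (y * z) = icirc x y * x^-1 * icirc x z.
Proof. by rewrite /icirc rrb_phiM !mulgA mulgVK. Qed.

HB.instance Definition _ := Group_isSkewBrace.Build induced
  icircA icirc1x icircx1 icircVx icircxV icircMr.

End Induced.

(* Main.v *)
From mathcomp Require Import all_boot.
From mathcomp Require Import boolp classical_sets.
Require Import Defs.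

(** Let (psi1, eta1) and (psi2, eta2) be the two isomorphisms of an isoclinism
    from X to Y. The skew left brace isoclinism is induced by psi1 and psi2
    alone, because both brace invariants are determined by omega and
    omega_phi.

    In the brace induced by X, the map [lam a] is phi_(R a), so [star a b] is
    the value of omega_phi at the classes of a and b. Hence:
    - an element a is annihilating iff omega (a, -), omega_phi (a, -) and
      omega_phi (-, a) are all trivial ([annihilatesP]). This condition lives
      on the quotient by Z^phi_R(H), and psi1 carries it from X to Y since
      psi2 is injective and psi1 is surjective ([annihilates_psi1]). The
      annihilator may be strictly larger than Z^phi_R(H), because it only asks
      for invariance under the image of R; the displayed criterion is what
      makes psi1 descend to an isomorphism xi1 of the quotients by the
      annihilators.
    - the commutator H' is generated, as a mere subgroup, by the commutators
      and the stars ([brace_comm_min]), that is, by the values of omega and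
      omega_phi. So psi2, which carries these values for X onto those for Y,
      maps H' onto K' ([psi2_brace_comm] and [brace_comm_psi2]), and xi2 is
      its restriction. *)

Set Implicit Arguments.
Unset Strict Implicit.
Unset Printing Implicit Defensive.

Local Open Scope classical_set_scope.
Local Open Scope quotient_scope.
Local Open Scope group_scope.

(** * The commutator of a skew left brace as a subgroup *)

Section StarSubgroup.
Variable A : skewBraceType.
Implicit Types a b c x y : A.

Definition star_gen : subgroup A := gen [set x : A | exists a b, x = star a b].

Lemma star_in a b : star a b \in subgroup_set star_gen.
Proof. by rewrite inE; apply: sub_gen; exists a, b. Qed.

Lemma starE a b : star a b = lam a b * b^-1.
Proof. by []. Qed.

Lemma star_gen_stable (f : A -> A) : {morph f : x y / x * y} ->
  (forall a b, f (star a b) \in subgroup_set star_gen) ->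
  forall x, x \in subgroup_set star_gen -> f x \in subgroup_set star_gen.
Proof.
move=> fM fstar x /set_mem Sx.
pose P := [set y | f y \in subgroup_set star_gen].
suff: P x by [].
apply: gen_ind Sx => [|_ [a [b ->]]]; last exact: fstar.
split=> [|u v /set_mem Pu /set_mem Pv]; apply: mem_set.
  by rewrite /P /mkset (morph1 fM) subgroup1.
by rewrite /P /mkset fM (morphV fM) subgroupM ?subgroupV.
Qed.

(** Expanding [star a (c * b)] gives [star a c * (c * star a b * c^-1)], so a
    conjugate of a star is a quotient of two stars. *)
Lemma star_gen_normal c x : x \in subgroup_set star_gen ->
  c * x * c^-1 \in subgroup_set star_gen.
Proof.
apply: (star_gen_stable (f := fun x => c * x * c^-1)) => [u v|a b].
  by rewrite !mulgA mulgVK.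
have -> : c * star a b * c^-1 = (star a c)^-1 * star a (c * b).
  by rewrite !starE lamM !invgM invgK !mulgA !mulgVK.
by rewrite subgroupM ?subgroupV ?star_in.
Qed.

(** The map [lam c] sends [star a b] to the star of the circle conjugate of a
    by c with [lam c b]. *)
Lemma star_gen_lam c x : x \in subgroup_set star_gen ->
  lam c x \in subgroup_set star_gen.
Proof.
apply: (star_gen_stable (@lamM A c)) => a b.
have -> : lam c (star a b) = star (c ∘ a ∘ cinv c) (lam c b).
  by rewrite !starE lamM lamV !lam_circ lamK.
exact: star_in.
Qed.

Lemma star_gen_circ x y : x \in subgroup_set star_gen ->
  y \in subgroup_set star_gen -> x ∘ y \in subgroup_set star_gen.
Proof. by move=> Sx Sy; rewrite circE subgroupM ?star_gen_lam. Qed.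

Lemma star_gen_cinv x : x \in subgroup_set star_gen ->
  cinv x \in subgroup_set star_gen.
Proof. by move=> Sx; rewrite cinvE star_gen_lam ?subgroupV. Qed.

Definition star_subBrace : subBrace A := SubBrace star_gen_circ star_gen_cinv.

(** With y the circle conjugate of x by c, one has
    [y = c * (lam c x * star y c^-1) * c^-1], because [lam y c^-1] equals
    [lam (c ∘ x) (cinv c)]. So y is an additive conjugate of the product of
    [lam c x] with a star. *)
Lemma star_gen_cnormal c x : x \in subgroup_set star_gen ->
  c ∘ x ∘ cinv c \in subgroup_set star_gen.
Proof.
move=> Sx; set y := c ∘ x ∘ cinv c.
have lamc : lam c (cinv c) = c^-1.
  by apply: (mulgI c); rewrite -circE circxV coneE mulgV.
have -> : y = c * (lam c x * star y c^-1) * c^-1.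
  have lamy : lam y c^-1 = lam (c ∘ x) (cinv c).
    by rewrite -lamc /y (lam_circ (c ∘ x)) lamK.
  rewrite starE lamy {1}/y [LHS]circE {1}(circE c).
  by move: (lam c x) (lam (c ∘ x) _) => u v; rewrite invgK !mulgA mulgK.
by apply: star_gen_normal; rewrite subgroupM ?star_gen_lam ?star_in.
Qed.

Definition star_ideal : ideal A :=
  @Ideal _ star_subBrace star_gen_normal star_gen_cnormal star_gen_lam.

(** The ideal generated by the stars is already the subgroup they generate,
    since that subgroup is an ideal. *)
Lemma brace_comm_min (S : subgroup A) :
  (forall a b, comm a b \in subgroup_set S) ->
  (forall a b, star a b \in subgroup_set S) ->
  forall x, x \in subgroup_set (brace_comm A) -> x \in subgroup_set S.
Proof.
move=> Scomm Sstar x /set_mem Cx; rewrite inE; apply: Cx => y [Dy | By].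
  by apply: Dy => _ [a [b ->]]; exact: set_mem (Scomm a b).
have : subgroup_set star_ideal y by apply: By => z Sz; exact: sub_gen.
by apply=> _ [a [b ->]]; exact: set_mem (Sstar a b).
Qed.

Lemma brace_comm_val (h : A) : h \in subgroup_set (brace_comm A) ->
  exists x : sbrace (brace_comm A), val x = h.
Proof. by move=> Ch; exists (Sub h Ch). Qed.

End StarSubgroup.

(** * The annihilator of an induced brace *)

Section InducedBrace.
Variable X : rrbGroup.
Local Notation piZ := (\pi_(quot (zcen X))).
Local Notation piA := (\pi_(qbrace (ann (induced X)))).

Lemma lam_induced (a b : induced X) : lam a b = rrb_phi (rrb_R a) b.
Proof. exact: mulKg. Qed.

Lemma star_induced (a b : induced X) :
  star a b = rrb_phi (rrb_R a) b * b^-1 :> rrbH X.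
Proof. by rewrite starE lam_induced. Qed.

(** The criterion for annihilating elements is phrased through omega and
    omega_phi only, the two maps that an isoclinism transports. *)
Definition annihilates (q : quot (zcen X)) : Prop :=
  forall b, [/\ omega q b = 1, omega_phi q b = 1 & omega_phi b q = 1].

Lemma annihilatesP (h : rrbH X) :
  annihilates (piZ h) <-> (h : induced X) \in @ann_set (induced X).
Proof.
split=> [Ah | /annP[ch lh fh] b].
  have eq1 (x y : rrbH X) : x * y^-1 = 1 -> x = y.
    by move=> e; rewrite -[x](mulgVK y) e mul1g.
  apply/annP; split=> b; have [e1 e2 e3] := Ah (piZ b).
  - apply: (eq1 (h * b) (b * h)); rewrite invgM mulgA.
    by rewrite -[LHS]/(comm h b) -omegaE e1.
  - by rewrite lam_induced; apply: eq1; rewrite -omega_phiE e2.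
  - by rewrite lam_induced; apply: eq1; rewrite -omega_phiE e3.
elim/quot_ind: b => b; split; apply: val_inj.
- by rewrite omegaE /comm [h * b]ch mulgK; exact: mulgV.
- by rewrite omega_phiE -[rrb_phi _ _]lam_induced lh; exact: mulgV.
- by rewrite omega_phiE -[rrb_phi _ _]lam_induced fh; exact: mulgV.
Qed.

Lemma zcen_ann (z : rrbH X) :
  z \in @zcen_set X -> (z : induced X) \in @ann_set (induced X).
Proof.
move=> /set_mem[[cz kz] fz].
by apply/annP; split=> b; rewrite ?lam_induced ?kz ?fz //; exact: cz.
Qed.

(** Evaluating at a representative is harmless, since Z^phi_R(H) lies in the
    annihilator ([zcen_ann]). *)
Definition to_ann (q : quot (zcen X)) : qbrace (ann (induced X)) :=
  piA (repr q : induced X).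

Lemma to_annE (h : rrbH X) : to_ann (piZ h) = piA (h : induced X).
Proof.
rewrite /to_ann; have [z Zz ->] := repr_pi (zcen X) h.
by apply: (pi_mulr (N := ideal_normalSubgroup (ann _))); exact: zcen_ann.
Qed.

Lemma to_annM : {morph to_ann : p q / p * q}.
Proof.
elim/quot_ind=> p; elim/quot_ind=> q.
by rewrite -piM !to_annE; exact: qbraceM.
Qed.

Lemma to_ann_circ (p q : rrbH (rrb_quot X)) :
  to_ann (p * rrb_phi (rrb_R p) q) = to_ann p ∘ to_ann q.
Proof.
elim/quot_ind: p => p; elim/quot_ind: q => q.
rewrite [rrb_R _]qRE [rrb_phi _ _]qphiE -piM !to_annE.
exact/esym/(@qcircE _ (ann (induced X))).
Qed.

Lemma to_ann_eq (p q : quot (zcen X)) :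
  to_ann p = to_ann q <-> annihilates (p^-1 * q).
Proof.
elim/quot_ind: p => p; elim/quot_ind: q => q.
rewrite !to_annE [(piZ p)^-1]qinvE -piM annihilatesP.
exact: (quotP (ideal_normalSubgroup (ann (induced X)))).
Qed.

Lemma to_ann_surj (x : qbrace (ann (induced X))) : exists q, to_ann q = x.
Proof. by elim/qbrace_ind: x => x; exists (piZ x); rewrite to_annE. Qed.

Lemma theta_to_ann (p q : quot (zcen X)) :
  val (theta (to_ann p) (to_ann q)) = val (omega p q) :> rrbH X.
Proof.
by elim/quot_ind: p => p; elim/quot_ind: q => q; rewrite !to_annE thetaE omegaE.
Qed.

Lemma theta_star_to_ann (p q : quot (zcen X)) :
  val (theta_star (to_ann p) (to_ann q)) = val (omega_phi p q) :> rrbH X.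
Proof.
elim/quot_ind: p => p; elim/quot_ind: q => q.
by rewrite !to_annE theta_starE omega_phiE star_induced.
Qed.

Lemma comm_omega (a b : induced X) :
  exists p q, comm a b = val (omega p q) :> rrbH X.
Proof. by exists (piZ a), (piZ b); exact/esym/omegaE. Qed.

Lemma star_omega_phi (a b : induced X) :
  exists p q, star a b = val (omega_phi p q) :> rrbH X.
Proof. by exists (piZ a), (piZ b); rewrite omega_phiE star_induced. Qed.

Lemma omega_brace_comm (p q : quot (zcen X)) :
  (val (omega p q) : induced X) \in subgroup_set (brace_comm (induced X)).
Proof. by rewrite -theta_to_ann; exact: valP. Qed.

Lemma omega_phi_brace_comm (p q : quot (zcen X)) :
  (val (omega_phi p q) : induced X) \in subgroup_set (brace_comm (induced X)).
Proof. by rewrite -theta_star_to_ann; exact: valP. Qed.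

Lemma val_circ (x y : sbrace (brace_comm (induced X))) :
  val (x ∘ y) = val x * rrb_phi (rrb_R (val x)) (val y) :> rrbH X.
Proof. by []. Qed.

(** The same circle operation, computed inside the commutator H^phi, where the
    operators are restrictions of those of X. *)
Lemma val_rrb_circ (u v : subg (Hphi X)) :
  val ((u : rrbH (rrb_comm X)) * rrb_phi (rrb_R (u : rrbH (rrb_comm X))) v)
  = val u * rrb_phi (rrb_R (val u)) (val v).
Proof. by []. Qed.

End InducedBrace.

(** * The isoclinism of the induced braces *)

Lemma inj_surj_bijective (T U : Type) (f : T -> U) :
  injective f -> (forall u, exists t, f t = u) -> bijective f.
Proof.
move=> fI /choice[g fg]; exists g => // t; apply: fI; exact: fg.
Qed.

Lemma bijective_surj (T U : Type) (f : T -> U) :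
  bijective f -> forall u, exists t, f t = u.
Proof. by case=> g _ gK u; exists (g u). Qed.

Section Isoclinism.
Variables (X Y : rrbGroup).
Variables (f1 : rrb_hom (rrb_quot X) (rrb_quot Y)).
Variables (f2 : rrb_hom (rrb_comm X) (rrb_comm Y)).
Hypotheses (f1iso : rrb_is_iso f1) (f2iso : rrb_is_iso f2).
Local Notation psi1 := (hom_psi f1 : quot (zcen X) -> quot (zcen Y)).
Local Notation psi2 := (hom_psi f2 : subg (Hphi X) -> subg (Hphi Y)).
Hypothesis psi_omega : forall a b, psi2 (omega a b) = omega (psi1 a) (psi1 b).
Hypothesis psi_omega_phi :
  forall a b, psi2 (omega_phi a b) = omega_phi (psi1 a) (psi1 b).

Lemma psi1M : {morph psi1 : p q / p * q}.
Proof. exact: (hom_psiM f1). Qed.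

Lemma psi2M : {morph psi2 : p q / p * q}.
Proof. exact: (hom_psiM f2). Qed.

Lemma psi1_surj q : exists p, psi1 p = q.
Proof. by case: f1iso => /bijective_surj + _; apply. Qed.

Lemma psi2_inj : injective psi2.
Proof. by case: f2iso => /bij_inj. Qed.

(** The criterion is a system of equations with right hand side 1: it is
    reflected by psi1 because psi2 is injective, and preserved because every
    element of the target of psi1 is an image. *)
Lemma annihilates_psi1 q : annihilates (psi1 q) <-> annihilates q.
Proof.
split=> Aq b.
  have [e1 e2 e3] := Aq (psi1 b); rewrite -psi_omega in e1.
  rewrite -!psi_omega_phi in e2 e3.
  by split; apply: psi2_inj; rewrite (morph1 psi2M).
have [p <-] := psi1_surj b; have [e1 e2 e3] := Aq p.
by rewrite -psi_omega -!psi_omega_phi e1 e2 e3 (morph1 psi2M).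
Qed.

Lemma to_ann_psi1 p q : to_ann (psi1 p) = to_ann (psi1 q) <-> to_ann p = to_ann q.
Proof.
by rewrite !to_ann_eq -(morphV psi1M) -psi1M annihilates_psi1.
Qed.

Definition xi1_fun (x : qbrace (ann (induced X))) : qbrace (ann (induced Y)) :=
  to_ann (psi1 (\pi_(quot (zcen X)) (repr x))).

Lemma xi1E p : xi1_fun (to_ann p) = to_ann (psi1 p).
Proof. by apply/to_ann_psi1; rewrite to_annE reprK. Qed.

Lemma xi1M : {morph xi1_fun : x y / x * y}.
Proof.
move=> x y; have [p <-] := to_ann_surj x; have [q <-] := to_ann_surj y.
by rewrite -to_annM !xi1E psi1M to_annM.
Qed.

Lemma xi1_circ : {morph xi1_fun : x y / x ∘ y}.
Proof.
move=> x y; have [p <-] := to_ann_surj x; have [q <-] := to_ann_surj y.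
by rewrite -to_ann_circ !xi1E psi1M hom_phi hom_R to_ann_circ.
Qed.

Lemma xi1_bij : bijective xi1_fun.
Proof.
apply: inj_surj_bijective => [x y|y].
  have [p <-] := to_ann_surj x; have [q <-] := to_ann_surj y.
  by rewrite !xi1E => /to_ann_psi1.
have [q <-] := to_ann_surj y; have [p <-] := psi1_surj q.
by exists (to_ann p); rewrite xi1E.
Qed.

Local Notation CX := (brace_comm (induced X)).
Local Notation CY := (brace_comm (induced Y)).

Lemma psi2_preimage_closed (S : subgroup (induced Y)) :
  group_closed (mem [set h : induced X | exists2 x : subg (Hphi X),
    val x = h & (val (psi2 x) : induced Y) \in subgroup_set S]).
Proof.
split=> [|_ _ /set_mem[x <- Sx] /set_mem[y <- Sy]]; rewrite inE.
  by exists 1 => //; rewrite (morph1 psi2M); exact: subgroup1.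
exists (x * y^-1) => //.
by rewrite psi2M (morphV psi2M); exact: subgroupM Sx (subgroupV Sy).
Qed.

(** The elements of H^phi that psi2 sends into a given subgroup form a
    subgroup, so only the generators of the brace commutator matter; these are
    values of omega and omega_phi, which psi2 respects. The lifting x also
    records that the brace commutator is contained in H^phi. *)
Lemma psi2_brace_comm (h : induced X) : h \in subgroup_set CX ->
  exists2 x : subg (Hphi X),
    val x = h & (val (psi2 x) : induced Y) \in subgroup_set CY.
Proof.
move=> Ch; apply: set_mem.
apply: (brace_comm_min (S := Subgroup (psi2_preimage_closed CY))) Ch => a b;
  rewrite inE /=.
  have [p [q ->]] := comm_omega a b.
  by exists (omega p q); rewrite // psi_omega omega_brace_comm.
have [p [q ->]] := star_omega_phi a b.
by exists (omega_phi p q); rewrite // psi_omega_phi omega_phi_brace_comm.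
Qed.

Lemma psi2_image_closed (S : subgroup (induced X)) :
  group_closed (mem [set k : induced Y | exists2 x : subg (Hphi X),
    val (psi2 x) = k & (val x : induced X) \in subgroup_set S]).
Proof.
split=> [|_ _ /set_mem[x <- Sx] /set_mem[y <- Sy]]; rewrite inE.
  by exists 1; [rewrite (morph1 psi2M) | exact: subgroup1].
exists (x * y^-1); last exact: subgroupM Sx (subgroupV Sy).
by rewrite psi2M (morphV psi2M).
Qed.

(** Surjectivity of psi1 makes every value of omega or omega_phi for Y the
    image under psi2 of such a value for X. *)
Lemma brace_comm_psi2 (k : induced Y) : k \in subgroup_set CY ->
  exists2 x : subg (Hphi X),
    val (psi2 x) = k & (val x : induced X) \in subgroup_set CX.
Proof.
move=> Ck; apply: set_mem.
apply: (brace_comm_min (S := Subgroup (psi2_image_closed CX))) Ck => a b;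
  rewrite inE /=.
  have [p [q ->]] := comm_omega a b.
  have [p' <-] := psi1_surj p; have [q' <-] := psi1_surj q.
  by exists (omega p' q'); rewrite ?psi_omega ?omega_brace_comm.
have [p [q ->]] := star_omega_phi a b.
have [p' <-] := psi1_surj p; have [q' <-] := psi1_surj q.
by exists (omega_phi p' q'); rewrite ?psi_omega_phi ?omega_phi_brace_comm.
Qed.

(** The two commutators H' and H^phi are separate subtypes of H, so the
    restriction of psi2 is defined by its graph: x' is x seen in H^phi. *)
Lemma xi2_exists (x : sbrace CX) : exists y : sbrace CY,
  forall x' : subg (Hphi X), val x' = val x -> val (psi2 x') = val y.
Proof.
have [x0 e0 Cx0] := psi2_brace_comm (valP x).
have [y vy] := brace_comm_val Cx0; exists y => x' ex'.
rewrite vy; congr (val (psi2 _)).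
by apply: val_inj; rewrite e0 ex'.
Qed.

Definition xi2_fun (x : sbrace CX) : sbrace CY := sval (cid (xi2_exists x)).

Lemma xi2E x (x' : subg (Hphi X)) :
  val x' = val x -> val (xi2_fun x) = val (psi2 x').
Proof. by move=> e; rewrite /xi2_fun; case: cid => y /= ->. Qed.

Lemma xi2_lift (x : sbrace CX) :
  exists2 x' : subg (Hphi X), val x' = val x & val (xi2_fun x) = val (psi2 x').
Proof.
by have [x' e _] := psi2_brace_comm (valP x); exists x' => //; exact: xi2E.
Qed.

Lemma xi2M : {morph xi2_fun : x y / x * y}.
Proof.
move=> x y; have [x' ex vx] := xi2_lift x; have [y' ey vy] := xi2_lift y.
apply: val_inj; rewrite (@xi2E _ (x' * y')); last by rewrite /= ex ey.
by rewrite psi2M /= vx vy.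
Qed.

Lemma xi2_circ : {morph xi2_fun : x y / x ∘ y}.
Proof.
move=> x y; have [x' ex vx] := xi2_lift x; have [y' ey vy] := xi2_lift y.
apply: val_inj.
pose u : rrbH (rrb_comm X) := x'.
rewrite (@xi2E _ (u * rrb_phi (rrb_R u) y')); last first.
  by rewrite val_rrb_circ ex ey.
by rewrite (hom_psiM f2) hom_phi hom_R val_rrb_circ -vx -vy.
Qed.

Lemma xi2_bij : bijective xi2_fun.
Proof.
apply: inj_surj_bijective => [x y exy|y].
  have [x' ex vx] := xi2_lift x; have [y' ey vy] := xi2_lift y.
  apply: val_inj; rewrite -ex -ey; congr val; apply: psi2_inj.
  by apply: val_inj; rewrite -vx -vy exy.
have [x e Cx] := brace_comm_psi2 (valP y).
have [x' vx'] := brace_comm_val Cx.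
by exists x'; apply: val_inj; rewrite (@xi2E _ x).
Qed.

Lemma xi2_theta x y : xi2_fun (theta x y) = theta (xi1_fun x) (xi1_fun y).
Proof.
have [p <-] := to_ann_surj x; have [q <-] := to_ann_surj y.
apply: val_inj; rewrite (@xi2E _ (omega p q)); last by rewrite theta_to_ann.
by rewrite !xi1E theta_to_ann psi_omega.
Qed.

Lemma xi2_theta_star x y :
  xi2_fun (theta_star x y) = theta_star (xi1_fun x) (xi1_fun y).
Proof.
have [p <-] := to_ann_surj x; have [q <-] := to_ann_surj y.
apply: val_inj; rewrite (@xi2E _ (omega_phi p q)).
  by rewrite !xi1E theta_star_to_ann psi_omega_phi.
by rewrite theta_star_to_ann.
Qed.

End Isoclinism.

Theorem theorem6p11 (X Y : rrbGroup) (hXY : rrb_isoclinic X Y) :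
  brace_isoclinic (induced X) (induced Y).
Proof.
case: hXY => f1 [f2 [f1iso f2iso om omphi]].
exists (BraceHom (xi1M f1iso f2iso om omphi) (xi1_circ f1iso f2iso om omphi)).
exists (BraceHom (xi2M om omphi) (xi2_circ om omphi)).
split.
- exact: (xi1_bij f1iso f2iso om omphi).
- exact: (xi2_bij f1iso f2iso om omphi).
- exact: (xi2_theta f1iso f2iso om omphi).
- exact: (xi2_theta_star f1iso f2iso om omphi).
Qed.
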